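(* Suppose page requests are generated by an unknown Markov chain on $n$ pages whose transition matrix $M$ satisfies $M_{i,j}\ge\delta>0$ for all $i,j$, and let $\gamma=\sup_{p\neq q}\|L_{p,q}^{-1}\|_\infty$. Let $\varepsilon\in(0,1/2)$. There is an absolute constant $C$ such that, given a training dataset of $m=C\,\frac{\gamma^2 n^2}{\varepsilon^2\delta}$ past page requests (consecutive samples $X_1,\dots,X_m$ of the chain with $M$, with arbitrary distribution of $X_1$), there is a paging algorithm $\mathcal{A}$ (which uses the dataset but not $M$) that, with probability at least $0.99$ over the $m$ samples, is $\frac{2}{1-2\varepsilon}$-competitive against $\mathrm{OPT}$ on a fresh request sequence drawn from the chain, i.e. $\mathbb{E}[\mathrm{cost}(\mathcal{A},T)]\le \frac{2}{1-2\varepsilon}\mathbb{E}[\mathrm{cost}(\mathrm{OPT},T)]$ for all $T$.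
   Context: Markov Paging model: there are $n$ pages and a cache of size $k$. Page requests are drawn from a time-homogeneous Markov chain on the $n$ pages with transition matrix $M$ ($M_{i,j}$ = probability that page $j$ is requested next given page $i$ was most recently requested). All algorithms start from the same initial cache of $k$ pages. On a request to a page not in the cache, the algorithm suffers a cache miss (unit cost) and must evict a page from its cache to bring in the requested page. $\mathrm{cost}(\mathcal{A},T)$ is the number of cache misses among the first $T$ requests; expectations are over the request sequence and the algorithm's randomness. $\mathrm{OPT}$ is the online policy that knows $M$ (but not the realized sequence) and minimizes expected cost. For distinct pages $p,q$, $L_{p,q}\in\mathbb{R}^{n\times n}$ is the matrix whose row $p$ is the standard basis row vector $e_p$, whose row $q$ is $e_q$, and whose row $r$ for every $r\notin\{p,q\}$ is $M(r,:)-e_r$ (the $r$-th row of $M$ minus $e_r$). (The solution $x$ of $L_{p,q}x=e_p$ has $x_s$ equal to the probability that $p$ is next requested before $q$ given $s$ was most recently requested.) For a square matrix $A$, $\|A\|_\infty=\max_i\sum_j|A_{i,j}|$. *)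

(* Defs.v *)
(* The state space and every horizon are finite,
   so all probabilities and expectations are finite sums. *)

(* In this order so that [set0] is the finset one. *)
From mathcomp Require Import boolp classical_sets reals.
From mathcomp Require Import all_boot all_order all_algebra.

Set Implicit Arguments.
Unset Strict Implicit.
Unset Printing Implicit Defensive.

Import Order.TTheory GRing.Theory Num.Theory.
Local Open Scope ring_scope.

Definition is_dist (R : realType) (T : finType) (f : T -> R) : Prop :=
  (forall x, 0 <= f x) /\ \sum_x f x = 1.

Definition stochastic (R : realType) (n : nat) (M : 'M[R]_n) : Prop :=
  forall i, is_dist (M i).

Definition chain_prob (R : realType) (n : nat)
    (mu : 'I_n -> R) (M : 'M[R]_n) (xs : seq 'I_n) : R :=
  if xs is x :: s then mu x * \prod_(e <- zip (x :: s) s) M e.1 e.2 else 1.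

Definition chain_Pr (R : realType) (n : nat)
    (mu : 'I_n -> R) (M : 'M[R]_n) (m : nat) (E : m.-tuple 'I_n -> Prop) : R :=
  \sum_(X : m.-tuple 'I_n | `[< E X >]) chain_prob mu M X.

(* [M] is row-stochastic with positive entries wherever [Lmx] is used, so
   [Lmx M p q] is invertible and [invmx] is its genuine inverse. *)
Definition Lmx (R : realType) (n : nat) (M : 'M[R]_n) (p q : 'I_n) : 'M[R]_n :=
  \matrix_(r < n)
    (if (r == p) || (r == q) then delta_mx 0 r else row r M - delta_mx 0 r).

(* The library norm on matrices is the entrywise maximum, hence this one. *)
Definition mxnorm_oo (R : realType) (n : nat) (A : 'M[R]_n) : R :=
  \big[Order.max/0]_(i < n) \sum_(j < n) `|A i j|.

(* For n = 1 there is no pair and the supremum is 0 by convention. *)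
Definition gamma (R : realType) (n : nat) (M : 'M[R]_n) : R :=
  sup [set g : R | exists p q : 'I_n,
        p != q /\ g = mxnorm_oo (invmx (Lmx M p q))]%classic.

(* What happens at one request: the requested page, and the evicted page, which
   is [None] exactly when the request is a hit. *)
Definition event (n : nat) : finType := ('I_n * option 'I_n)%type.

Definition serve (n : nat) (c : {set 'I_n}) (s : event n) : {set 'I_n} :=
  if s.2 is Some q then s.1 |: (c :\ q) else c.

(* A randomized online paging algorithm: [evict h c x q] is the probability of
   evicting [q] when [x] is requested and missed, given the events [h] so far
   (oldest first) and the current cache [c].  Conditioning on the full past,
   own random choices included, loses no generality. *)
Record policy (R : realType) (n : nat) := Policy {
  evict :> seq (event n) -> {set 'I_n} -> 'I_n -> 'I_n -> R;
  evict_dist : forall h c x, c != set0 -> x \notin c -> is_dist (evict h c x);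
  evict_cache : forall h c x q, c != set0 -> x \notin c -> q \notin c ->
    evict h c x q = 0 }.

Definition step_prob (R : realType) (n : nat) (pi : policy R n)
    (h : seq (event n)) (c : {set 'I_n}) (s : event n) : R :=
  match s.2 with
  | None => (s.1 \in c)%:R
  | Some q => if s.1 \in c then 0 else pi h c s.1 q
  end.

(* Probability that [pi] reacts as recorded in [w], given the requests in [w]. *)
Fixpoint run_prob (R : realType) (n : nat) (pi : policy R n)
    (h : seq (event n)) (c : {set 'I_n}) (w : seq (event n)) : R :=
  if w is s :: w' then
    step_prob pi h c s * run_prob pi (rcons h s) (serve c s) w'
  else 1.

Fixpoint misses (n : nat) (c : {set 'I_n}) (w : seq (event n)) : nat :=
  if w is s :: w' then ((s.1 \notin c) + misses (serve c s) w')%N else 0%N.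

Definition expected_cost (R : realType) (n : nat) (nu : 'I_n -> R)
    (M : 'M[R]_n) (c0 : {set 'I_n}) (pi : policy R n) (T : nat) : R :=
  \sum_(w : T.-tuple (event n))
    chain_prob nu M (unzip1 w) * run_prob pi [::] c0 w * (misses c0 w)%:R.

(* The infimum ranges over all online policies, which may depend on [M], [nu]
   and [T]; it is attained (backward induction on the finite horizon). *)
Definition opt_cost (R : realType) (n : nat) (nu : 'I_n -> R)
    (M : 'M[R]_n) (c0 : {set 'I_n}) (T : nat) : R :=
  inf [set e : R | exists pi : policy R n,
        e = expected_cost nu M c0 pi T]%classic.

(* The law [nu] of the first request of the fresh sequence is arbitrary. *)
Definition competitive (R : realType) (n : nat) (a : R) (M : 'M[R]_n)
    (c0 : {set 'I_n}) (pi : policy R n) : Prop :=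
  forall (nu : 'I_n -> R) (T : nat), is_dist nu ->
    expected_cost nu M c0 pi T <= a * opt_cost nu M c0 T.

Definition sample_size (R : realType) (n : nat) (C eps delta : R)
    (M : 'M[R]_n) : nat :=
  `|Num.ceil (C * (gamma M ^+ 2 * n%:R ^+ 2 / (eps ^+ 2 * delta)))|%N.

(* Main.v *)
(* Let [ahead r p q] be the probability that [p] is requested before [q] when
   [r] was requested last; it satisfies a triangle inequality in [p], [q] and
   is a martingale until [p] or [q] is requested.  Against any policy [O],
   maintain an injection [f] from its cache into the algorithm's cache, with
   potential the sum over [o] of [ahead r o (f o)].  If every eviction of the
   algorithm is drawn from a distribution [D] with
   [sum_t D t * ahead r t q <= 1/2 + eps] for all cached [q], then (1/2 - eps)
   times a miss of the algorithm plus the expected increase of the potential is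
   at most a miss of [O]; this gives the ratio 2 / (1 - 2 eps).

   Such a [D] exists up to an error because [ahead p q - ahead q p] is a
   skew-symmetric game, and it can be computed from any matrix whose rows are
   within eps / (4 gamma) of those of [M] in l1 norm, by perturbation of the
   linear system defining [ahead].  The empirical frequencies over the first [K]
   visits to each page have this accuracy by Chebyshev's inequality applied to
   two martingales, one for the frequencies and one for the visit counts. *)
Require Import Defs.
From mathcomp Require Import boolp classical_sets reals.
From mathcomp Require Import all_boot all_order all_algebra.
From mathcomp Require Import ring lra.

Set Implicit Arguments.
Unset Strict Implicit.
Unset Printing Implicit Defensive.

Import Order.TTheory GRing.Theory Num.Theory.
Local Open Scope ring_scope.

(** * Hitting probabilities *)

(** The rows of [kermx A^T], transposed, are killed by [A]. Invertibility can thus be proved as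
    uniqueness for a linear system. *)
Lemma unitmx_inj (F : fieldType) (n : nat) (A : 'M[F]_n) :
  (forall v : 'I_n -> F,
     (forall r, \sum_s A r s * v s = 0) -> forall s, v s = 0) ->
  A \in unitmx.
Proof.
move=> injA; rewrite -unitmx_tr -row_free_unit -kermx_eq0.
have kA : A *m (kermx A^T)^T = 0.
  by apply: trmx_inj; rewrite trmx_mul trmxK mulmx_ker trmx0.
apply/eqP/matrixP => i j; rewrite [RHS]mxE.
move: j; apply: (injA (fun s => kermx A^T i s)) => r.
have /matrixP/(_ r i) := kA; rewrite [RHS]mxE mxE => kri.
by rewrite -[RHS]kri; apply: eq_bigr => s _; rewrite [in RHS]mxE.
Qed.

Lemma LmxE (R : realType) (n : nat) (M : 'M[R]_n) (p q r s : 'I_n) :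
  Lmx M p q r s =
  if (r == p) || (r == q) then (s == r)%:R else M r s - (s == r)%:R.
Proof. by rewrite mxE; case: ifP => _; rewrite !mxE eqxx. Qed.

Lemma sum_Lmx (R : realType) (n : nat) (M : 'M[R]_n) (p q r : 'I_n)
    (v : 'I_n -> R) :
  \sum_s Lmx M p q r s * v s =
  if (r == p) || (r == q) then v r else \sum_s M r s * v s - v r.
Proof.
have sum_eq : \sum_s (s == r)%:R * v s = v r.
  rewrite (bigD1 r) //= eqxx mul1r big1 ?addr0 // => s /negPf ->.
  by rewrite mul0r.
rewrite (eq_bigr _ (fun s _ => congr1 (fun a => a * v s) (LmxE M p q r s))).
case: ifP => _ //; rewrite -[X in _ = _ - X]sum_eq -sumrB.
by apply: eq_bigr => s _; rewrite mulrBl.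
Qed.

(** Column [p] of the inverse solves the system with right-hand side [e_p]. [M] is arbitrary because
    empirical matrices are plugged in as well. *)
Definition hit (R : realType) (n : nat) (M : 'M[R]_n) (p q r : 'I_n) : R :=
  invmx (Lmx M p q) r p.

Lemma sum_Lmx_hit (R : realType) (n : nat) (M : 'M[R]_n) (p q r : 'I_n) :
  Lmx M p q \in unitmx -> \sum_s Lmx M p q r s * hit M p q s = (r == p)%:R.
Proof.
by move=> /mulmxV /matrixP /(_ r p); rewrite !mxE.
Qed.

Section Chain.
Variables (R : realType) (n : nat) (M : 'M[R]_n).
Hypotheses (stM : stochastic M) (M_gt0 : forall i j, 0 < M i j).

(* Minimum principle: at an argmin outside [B], averaging over all pages
   forces the minimal value to be attained on [B] as well. *)
Lemma harmonic_ge0 (B : pred 'I_n) (b : 'I_n) (y : 'I_n -> R) :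
  B b -> (forall r, B r -> 0 <= y r) ->
  (forall r, ~~ B r -> y r = \sum_s M r s * y s) -> forall r, 0 <= y r.
Proof.
move=> Bb yB yH r.
case: (@arg_minP _ _ _ r predT y isT) => m _ minm.
apply: le_trans (minm r isT).
case Bm: (B m); first exact: yB.
have ym : M m b * y m >= M m b * y b.
  have : \sum_s M m s * y m = \sum_s M m s * y s.
    by rewrite -mulr_suml (stM m).2 mul1r yH ?Bm.
  rewrite (bigD1 b) //= [RHS](bigD1 b) //= => e.
  have : \sum_(i | i != b) M m i * y m <= \sum_(i | i != b) M m i * y i.
    by apply: ler_sum => s _; apply: ler_wpM2l; [exact: ltW|exact: minm].
  lra.
rewrite ler_pM2l // in ym.
by apply: le_trans ym; apply: yB.
Qed.

Lemma sum_stoch (r : 'I_n) (c : R) : \sum_s M r s * c = c.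
Proof. by rewrite -mulr_suml (stM r).2 mul1r. Qed.

(** A kernel vector vanishes at [p] and [q] and is harmonic elsewhere; the minimum principle for it
    and for its negative makes it zero. *)
Lemma Lmx_unit (p q : 'I_n) : Lmx M p q \in unitmx.
Proof.
apply: unitmx_inj => v Lv s.
pose B r := (r == p) || (r == q).
have vB r : B r -> v r = 0
  by move=> Br; have := Lv r; rewrite sum_Lmx -/(B r) Br.
have vH r : ~~ B r -> v r = \sum_s M r s * v s.
  move=> /negPf Br; have := Lv r; rewrite sum_Lmx -/(B r) Br => /eqP.
  by rewrite subr_eq0 => /eqP.
have Bp : B p by rewrite /B eqxx.
apply/eqP; rewrite eq_le -oppr_ge0; apply/andP; split.
  apply: (harmonic_ge0 (y := fun s => - v s) Bp) => r Br.
    by rewrite vB ?oppr0.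
  by rewrite vH // -sumrN; apply: eq_bigr => t _; rewrite mulrN.
by apply: (harmonic_ge0 Bp) => r Br; [rewrite vB|exact: vH].
Qed.

Lemma hit_source (p q : 'I_n) : hit M p q p = 1.
Proof. by have := sum_Lmx_hit p (Lmx_unit p q); rewrite sum_Lmx eqxx. Qed.

Lemma hit_target (p q : 'I_n) : p != q -> hit M p q q = 0.
Proof.
move=> pq; have := sum_Lmx_hit q (Lmx_unit p q).
by rewrite sum_Lmx eqxx orbT eq_sym (negPf pq).
Qed.

Lemma hit_harmonic (p q r : 'I_n) : r != p -> r != q ->
  hit M p q r = \sum_s M r s * hit M p q s.
Proof.
move=> /negPf rp /negPf rq; have := sum_Lmx_hit r (Lmx_unit p q).
by rewrite sum_Lmx rp rq /= => /eqP; rewrite subr_eq0 => /eqP.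
Qed.

Lemma hit_ge0 (p q r : 'I_n) : p != q -> 0 <= hit M p q r.
Proof.
move=> pq; apply: (harmonic_ge0 (B := pred2 p q) (b := p)) => [|s|s] /=.
- by rewrite eqxx.
- by case/orP=> /eqP ->; rewrite ?hit_source ?hit_target.
- by rewrite negb_or => /andP[]; exact: hit_harmonic.
Qed.

(** The sum minus 1 vanishes at [p] and [q] and is harmonic elsewhere, so the minimum principle
    applies with both signs. *)
Lemma hit_compl (p q r : 'I_n) : p != q -> hit M p q r + hit M q p r = 1.
Proof.
move=> pq; have qp : q != p by rewrite eq_sym.
pose y s := hit M p q s + hit M q p s - 1.
have yB s : pred2 p q s -> y s = 0.
  by case/orP=> /eqP ->; rewrite /y hit_source hit_target //; lra.
have yH s : ~~ pred2 p q s -> y s = \sum_t M s t * y t.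
  rewrite /= negb_or => /andP[sp sq].
  rewrite /y hit_harmonic // (@hit_harmonic q p) //.
  rewrite -[X in _ - X = _](sum_stoch s 1) -big_split -sumrB /=.
  by apply: eq_bigr => t _; lra.
have Bp : pred2 p q p by rewrite /= eqxx.
have y0 : 0 <= y r by apply: (harmonic_ge0 Bp) => s Bs; [rewrite yB|exact: yH].
have y1 : 0 <= - y r.
  apply: (harmonic_ge0 (y := fun s => - y s) Bp) => s Bs.
    by rewrite yB ?oppr0.
  by rewrite yH // -sumrN; apply: eq_bigr => t _; rewrite mulrN.
by rewrite /y in y0 y1; lra.
Qed.

Lemma hit_le1 (p q r : 'I_n) : p != q -> hit M p q r <= 1.
Proof.
move=> pq; rewrite -(hit_compl r pq) lerDl hit_ge0 //.
by rewrite eq_sym.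
Qed.

(** If [p] comes before [q], then [p] comes before [t] or [t] before [q]. Analytically, the
    difference of the two sides is harmonic off the three pages and nonnegative on them. *)
Lemma hit_triangle (p t q r : 'I_n) : p != t -> t != q -> p != q ->
  hit M p q r <= hit M p t r + hit M t q r.
Proof.
move=> pt tq pq.
pose y s := hit M p t s + hit M t q s - hit M p q s.
suff : 0 <= y r by rewrite /y subr_ge0.
apply: (@harmonic_ge0 [pred s | [|| s == p, s == q | s == t]] p)
  => [|s|s] /=.
- by rewrite eqxx.
- rewrite /y; case/or3P=> /eqP ->.
  + by rewrite !hit_source; have := hit_ge0 p tq; lra.
  + by rewrite !(hit_target pq) !(hit_target tq); have := hit_ge0 q pt; lra.
  + by rewrite hit_source hit_target //; have := hit_le1 t pq; lra.
- rewrite !negb_or => /and3P[sp sq st].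
  rewrite /y !(@hit_harmonic _ _ s) // -big_split -sumrB /=.
  by apply: eq_bigr => u _; lra.
Qed.

(* The diagonal of [hit] is junk; a page is never requested before itself. *)
Definition ahead (r p q : 'I_n) : R := if p == q then 0 else hit M p q r.

Lemma ahead_diag (r p : 'I_n) : ahead r p p = 0.
Proof. by rewrite /ahead eqxx. Qed.

Lemma ahead_ge0 (r p q : 'I_n) : 0 <= ahead r p q.
Proof. by rewrite /ahead; case: ifPn => // /hit_ge0. Qed.

Lemma ahead_le1 (r p q : 'I_n) : ahead r p q <= 1.
Proof. by rewrite /ahead; case: ifPn => // /hit_le1. Qed.

Lemma ahead_source (r q : 'I_n) : r != q -> ahead r r q = 1.
Proof. by move=> /negPf rq; rewrite /ahead rq hit_source. Qed.

Lemma ahead_triangle (r p t q : 'I_n) :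
  ahead r p q <= ahead r p t + ahead r t q.
Proof.
case: (eqVneq p t) => [->|pt]; first by rewrite ahead_diag add0r.
case: (eqVneq t q) => [->|tq]; first by rewrite ahead_diag addr0.
case: (eqVneq p q) => [->|pq]; first by rewrite ahead_diag addr_ge0 ?ahead_ge0.
by rewrite /ahead (negPf pt) (negPf tq) (negPf pq) hit_triangle.
Qed.

Lemma ahead_harmonic (r p q : 'I_n) : r != p -> r != q ->
  \sum_s M r s * ahead s p q = ahead r p q.
Proof.
move=> rp rq; rewrite /ahead; case: ifP => _; last by rewrite -hit_harmonic.
by rewrite big1 // => s _; rewrite mulr0.
Qed.

End Chain.

(** * Skew-symmetric games *)

(** A skew-symmetric game has value zero. After [N] rounds the sum of squared positive payoffs is at
    most [N * B], so the averaged strategy concedes at most the square root of [B / N]. *)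
Lemma skew_game (R : realType) (T : finType) (K : T -> T -> R) (c : {set T})
    (e : R) :
  (forall p q, K p q = - K q p) -> 0 < e -> c != set0 ->
  exists D : T -> R,
    [/\ is_dist D, forall q, q \notin c -> D q = 0
      & forall q, q \in c -> \sum_p D p * K p q <= e].
Proof.
move=> skK e0 /set0Pn[p0 p0c].
pose pos (x : R) := Num.max 0 x.
(* A crude bound on the squared length of the payoff vector of any mixed strategy. *)
pose B := \sum_q (\sum_p `|K p q|) ^+ 2.
have B0 : 0 <= B by apply: sumr_ge0 => q _; apply: sqr_ge0.
have vB (D : T -> R) : is_dist D -> \sum_(q in c) (\sum_p D p * K p q) ^+ 2 <= B.
  move=> [D0 D1]; rewrite /B [leRHS](bigID (mem c)) /= -[leLHS]addr0 lerD //.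
    apply: ler_sum => q _; rewrite -real_normK ?num_real //.
    rewrite lerXn2r ?nnegrE ?normr_ge0 ?sumr_ge0 //.
    apply: le_trans (ler_norm_sum _ _ _) _; apply: ler_sum => p _.
    rewrite normrM ger0_norm //; apply: ler_piMl => //.
    by rewrite -D1 (bigD1 p) //= lerDl sumr_ge0.
  by apply: sumr_ge0 => q _; apply: sqr_ge0.
(* Regret matching: the next mixed strategy is proportional to the positive
   part of the accumulated payoffs, hence orthogonal to its own payoff. *)
have regret : forall N : nat, exists w : T -> R,
    [/\ forall p, 0 <= w p, \sum_p w p = N%:R, forall p, p \notin c -> w p = 0
      & \sum_(q in c) pos (\sum_p w p * K p q) ^+ 2 <= N%:R * B].
  elim=> [|N [w [w0 w1 wc wB]]].
    exists (fun=> 0); split=> //; first by rewrite big1.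
    rewrite mul0r big1 // => q _; rewrite big1 ?/pos ?maxxx ?expr0n // => p _.
    by rewrite mul0r.
  pose u q := \sum_p w p * K p q.
  pose a q := if q \in c then pos (u q) else 0.
  have a0 q : 0 <= a q by rewrite /a; case: ifP => // _; rewrite le_max lexx.
  have [D [[D0 D1] Dc Da]] : exists D : T -> R, [/\ is_dist D,
      forall p, p \notin c -> D p = 0
      & \sum_q a q * (\sum_p D p * K p q) = 0].
    have [s0|s_neq0] := eqVneq (\sum_q a q) 0.
      have aE q : a q = 0.
        by apply: (psumr_eq0P _ s0).
      (* Without positive accumulated payoff any strategy supported in [c] will do. *)
      exists (fun p => (p == p0)%:R); split; [split| |].
      - by move=> p; rewrite ler0n.
      - by rewrite (bigD1 p0) //= eqxx big1 ?addr0 // => p /negPf ->.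
      - by move=> p; case: eqP => // ->; rewrite p0c.
      - by rewrite big1 // => q _; rewrite aE mul0r.
    exists (fun p => a p / \sum_q a q); split; [split| |].
    - by move=> p; rewrite divr_ge0 ?sumr_ge0.
    - by rewrite -mulr_suml divff.
    - by move=> p /negPf pc; rewrite /a pc mul0r.
    (* Skew symmetry kills the quadratic form of [K] at [a]. *)
    - pose S := \sum_q \sum_p a q * (a p * K p q).
      have S0 : S = 0.
        suff : S = - S by lra.
        have {1}-> : S = \sum_p \sum_q a q * (a p * K p q) by exact: exchange_big.
        rewrite -sumrN; apply: eq_bigr => q _.
        by rewrite -sumrN; apply: eq_bigr => p _; rewrite (skK q p); ring.
      apply: etrans (_ : S / (\sum_q a q) = 0); last by rewrite S0 mul0r.
      rewrite /S mulr_suml; apply: eq_bigr => q _.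
      by rewrite mulr_sumr mulr_suml; apply: eq_bigr => p _; ring.
  exists (fun p => w p + D p); split.
  - by move=> p; rewrite addr_ge0.
  - by rewrite big_split /= w1 D1 -natr1.
  - by move=> p pc; rewrite wc ?Dc ?addr0.
  - pose v q := \sum_p D p * K p q.
    have uv q : \sum_p (w p + D p) * K p q = u q + v q.
      by rewrite -big_split; apply: eq_bigr => p _; rewrite mulrDl.
    (* The inserted cross term is zero by [Da]; it completes the square of [a q + v q], which
       dominates the new positive part because [u q <= a q]. *)
    have -> : N.+1%:R * B = N%:R * B + \sum_(q in c) 2 * (a q * v q) + B.
      rewrite -mulr_sumr (_ : \sum_(q in c) _ = 0) ?mulr0 -?natr1; first lra.
      rewrite -[RHS]Da [RHS](bigID (mem c)) /= [X in _ + X]big1 ?addr0 //.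
      by move=> q /negPf qc; rewrite /a qc mul0r.
    apply: le_trans (_ : \sum_(q in c) (a q + v q) ^+ 2 <= _); last first.
      apply: le_trans (_ : \sum_(q in c) (a q ^+ 2 + 2 * (a q * v q) + v q ^+ 2)
        <= _).
        by apply: ler_sum => q _; rewrite sqrrD; lra.
      rewrite !big_split /= !lerD ?vB //.
      by apply: le_trans wB; apply: ler_sum => q qc; rewrite /a qc.
    apply: ler_sum => q qc; rewrite uv /pos.
    case: (leP 0 (u q + v q)) => uv0; last by rewrite expr0n sqr_ge0.
    have ua : u q <= a q by rewrite /a qc le_max lexx orbT.
    by rewrite lerXn2r ?nnegrE //; lra.
(* Enough rounds for [B < N * e ^ 2]: a single payoff above [N * e] would then contradict [wB]. *)
pose N := (Num.truncn (B / e ^+ 2)).+1.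
have N_gt0 : 0 < N%:R :> R by rewrite ltr0n.
have NB : B < N%:R * e ^+ 2.
  rewrite -ltr_pdivrMr ?exprn_gt0 // /N.
  by have /andP[] := truncn_itv (divr_ge0 B0 (sqr_ge0 e)).
have [w [w0 w1 wc wB]] := regret N.
exists (fun p => w p / N%:R); split.
- split=> [p|]; first by rewrite divr_ge0 ?w0 ?ler0n.
  by rewrite -mulr_suml w1 divff ?gt_eqF.
- by move=> q qc; rewrite wc ?mul0r.
move=> q qc.
rewrite (eq_bigr (fun p => w p * K p q / N%:R)); last by move=> p _; lra.
rewrite -mulr_suml ler_pdivrMr // mulrC leNgt; apply/negP => u_gt.
have Ne : 0 < N%:R * e by rewrite mulr_gt0.
have : N%:R * B < N%:R * (N%:R * e ^+ 2) by rewrite ltr_pM2l.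
suff : N%:R * e * (N%:R * e) < N%:R * B by lra.
apply: lt_le_trans wB; rewrite (bigD1 q) //=.
apply: ltr_wpDr; first by apply: sumr_ge0 => ? _; apply: sqr_ge0.
rewrite /pos max_r; last by apply: ltW; apply: lt_trans u_gt.
rewrite -expr2 ltr_pXn2r ?nnegrE // ltW //.
exact: lt_trans u_gt.
Qed.

(** * Comparison of two policies *)

Lemma sum_tupleS (V : nmodType) (A : finType) (T : nat) (F : seq A -> V) :
  \sum_(w : T.+1.-tuple A) F w = \sum_a \sum_(w : T.-tuple A) F (a :: w).
Proof.
rewrite pair_bigA /=.
rewrite (reindex (fun p : A * T.-tuple A => [tuple of p.1 :: p.2])) //=.
exists (fun w : T.+1.-tuple A => (thead w, [tuple of behead w])).
  by move=> [a w] _; congr (_, _); apply: val_inj.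
by move=> w _; rewrite /= -tuple_eta.
Qed.

Lemma sum_tuple0 (V : nmodType) (A : finType) (F : seq A -> V) :
  \sum_(w : 0.-tuple A) F w = F [::].
Proof.
rewrite (bigD1 [tuple]) //= big1 ?addr0 // => w /eqP.
by rewrite tuple0.
Qed.

Lemma sum_pair (V : nmodType) (A B : finType) (F : A * B -> V) :
  \sum_p F p = \sum_a \sum_b F (a, b).
Proof. by rewrite pair_bigA; apply: eq_bigr => -[]. Qed.

Lemma sum_option (V : nmodType) (A : finType) (F : option A -> V) :
  \sum_e F e = F None + \sum_a F (Some a).
Proof.
rewrite (bigD1 None) //=; congr (_ + _).
rewrite (reindex_omap Some id) /=; last by case.
by apply: eq_bigl => a; rewrite eqxx.
Qed.

(** Markov property: after [x] the remaining requests form a chain with initial law [M x]. *)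
Lemma chain_prob_cons (R : realType) (n : nat) (M : 'M[R]_n) (nu : 'I_n -> R)
    (x : 'I_n) (s : seq 'I_n) :
  chain_prob nu M (x :: s) = nu x * chain_prob (M x) M s.
Proof. by case: s => [|y s] /=; rewrite ?big_nil // big_cons. Qed.

Section Cost.
Variables (R : realType) (n : nat) (M : 'M[R]_n).
Hypothesis stM : stochastic M.

(** [expected_cost] with history and cache left free, for induction on the horizon. *)
Definition cost_from (pi : policy R n) (nu : 'I_n -> R) (T : nat)
    (h : seq (event n)) (c : {set 'I_n}) : R :=
  \sum_(w : T.-tuple (event n))
    chain_prob nu M (unzip1 w) * run_prob pi h c w * (misses c w)%:R.

(* Law of the page leaving the cache on a request to [r], with the convention
   that a hit exchanges [r] for itself; [trace] is the recorded event. *)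
Definition leave (pi : policy R n) (h : seq (event n)) (c : {set 'I_n})
    (r t : 'I_n) : R :=
  if r \in c then (t == r)%:R else pi h c r t.

Definition trace (c : {set 'I_n}) (r t : 'I_n) : event n :=
  (r, if r \in c then None else Some t).

Definition swap (c : {set 'I_n}) (r t : 'I_n) : {set 'I_n} := r |: (c :\ t).

Lemma swap_neq0 (c : {set 'I_n}) (r t : 'I_n) : swap c r t != set0.
Proof. by apply/set0Pn; exists r; rewrite setU11. Qed.

Lemma leave_ge0 (pi : policy R n) h (c : {set 'I_n}) (r t : 'I_n) :
  c != set0 -> 0 <= leave pi h c r t.
Proof.
move=> c0; rewrite /leave; case: ifPn => [_|rc]; first by rewrite ler0n.
exact: (evict_dist pi h c0 rc).1.
Qed.

Lemma sum_leave (pi : policy R n) h (c : {set 'I_n}) (r : 'I_n) :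
  c != set0 -> \sum_t leave pi h c r t = 1.
Proof.
move=> c0; rewrite /leave; have [rc|rc] := boolP (r \in c); last first.
  exact: (evict_dist pi h c0 rc).2.
by rewrite (bigD1 r) //= eqxx big1 ?addr0 // => t /negPf ->.
Qed.

Lemma leave_supp (pi : policy R n) h (c : {set 'I_n}) (r t : 'I_n) :
  c != set0 -> leave pi h c r t != 0 -> t \in c /\ (r \in c -> t = r).
Proof.
move=> c0; rewrite /leave; case: ifPn => [rc|rc].
  by case: (eqVneq t r) => [->|_]; rewrite ?eqxx.
move=> pi0; split=> //; apply: contra_neqT pi0 => tc.
exact: evict_cache.
Qed.

(** Passing from recorded events to the departing page removes the distinction between hits and
    misses. *)
Lemma sum_step (pi : policy R n) h (c : {set 'I_n}) (r : 'I_n)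
    (G : event n -> {set 'I_n} -> R) :
  \sum_e step_prob pi h c (r, e) * G (r, e) (serve c (r, e)) =
  \sum_t leave pi h c r t * G (trace c r t) (swap c r t).
Proof.
rewrite sum_option /step_prob /leave /trace /swap /serve /=.
have [rc|rc] := boolP (r \in c).
  rewrite mul1r big1 ?addr0 => [|t _]; last by rewrite mul0r.
  rewrite (bigD1 r) //= eqxx mul1r setD1K // big1 ?addr0 // => t /negPf ->.
  by rewrite mul0r.
by rewrite mul0r add0r.
Qed.

(** Total mass one lets the cost of the first request leave the sum over futures in [cost_fromS]. *)
Lemma mass_from (pi : policy R n) (T : nat) (nu : 'I_n -> R) h
    (c : {set 'I_n}) : is_dist nu -> c != set0 ->
  \sum_(w : T.-tuple (event n))
    chain_prob nu M (unzip1 w) * run_prob pi h c w = 1.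
Proof.
elim: T nu h c => [|T IH] nu h c nu1 c0.
  by rewrite (sum_tuple0 (fun w =>
    chain_prob nu M (unzip1 w) * run_prob pi h c w)) /= mulr1.
rewrite (sum_tupleS T (fun w => chain_prob nu M (unzip1 w) * run_prob pi h c w)).
rewrite sum_pair.
rewrite -[RHS]nu1.2; apply: eq_bigr => r _.
pose G s c' := nu r * \sum_(w : T.-tuple (event n))
  chain_prob (M r) M (unzip1 w) * run_prob pi (rcons h s) c' w.
transitivity (\sum_e step_prob pi h c (r, e) * G (r, e) (serve c (r, e))).
  apply: eq_bigr => e _; rewrite /G !mulr_sumr; apply: eq_bigr => w _.
  by rewrite -[unzip1 (_ :: w)]/(r :: unzip1 w) chain_prob_cons /=; ring.
rewrite (sum_step pi h c r G) (eq_bigr (fun t => leave pi h c r t * nu r)) => [|t _].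
  by rewrite -mulr_suml sum_leave // mul1r.
by rewrite /G IH ?mulr1 // swap_neq0.
Qed.

Lemma cost_from0 (pi : policy R n) (nu : 'I_n -> R) h (c : {set 'I_n}) :
  cost_from pi nu 0 h c = 0.
Proof.
by rewrite /cost_from (sum_tuple0 (fun w =>
  chain_prob nu M (unzip1 w) * run_prob pi h c w * (misses c w)%:R)) /= mulr0.
Qed.

Lemma cost_fromS (pi : policy R n) (nu : 'I_n -> R) (T : nat) h
    (c : {set 'I_n}) : c != set0 ->
  cost_from pi nu T.+1 h c =
  \sum_r nu r * \sum_t leave pi h c r t *
    ((r \notin c)%:R +
     cost_from pi (M r) T (rcons h (trace c r t)) (swap c r t)).
Proof.
move=> c0; rewrite /cost_from (sum_tupleS T (fun w =>
  chain_prob nu M (unzip1 w) * run_prob pi h c w * (misses c w)%:R)).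
rewrite sum_pair.
apply: eq_bigr => r _.
pose G s c' : R := (r \notin c)%:R + cost_from pi (M r) T (rcons h s) c'.
rewrite -(sum_step pi h c r G) mulr_sumr; apply: eq_bigr => e _.
have [st0|st_neq0] := eqVneq (step_prob pi h c (r, e)) 0.
  rewrite st0 mul0r mulr0 big1 // => w _.
  by rewrite [run_prob _ _ _ _]mulrC st0 !(mul0r, mulr0).
have c'0 : serve c (r, e) != set0.
  by rewrite /serve; case: e {st_neq0} => [q|] //=; apply: swap_neq0.
have -> : G (r, e) (serve c (r, e)) = \sum_(w : T.-tuple (event n))
    (chain_prob (M r) M (unzip1 w) *
       run_prob pi (rcons h (r, e)) (serve c (r, e)) w) *
    ((r \notin c) + misses (serve c (r, e)) w)%N%:R.
  have := congr1 (fun x => (r \notin c)%:R * x)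
    (mass_from pi T (rcons h (r, e)) (stM r) c'0).
  rewrite /G mulr1 => <-; rewrite mulr_sumr -big_split.
  by apply: eq_bigr => w _; rewrite natrD /=; ring.
rewrite 2!mulr_sumr; apply: eq_bigr => w _.
by rewrite -[unzip1 (_ :: w)]/(r :: unzip1 w) chain_prob_cons /=; ring.
Qed.

End Cost.

Section Compare.
Variables (R : realType) (n : nat) (M : 'M[R]_n).
Hypotheses (stM : stochastic M) (M_gt0 : forall i j, 0 < M i j).

Definition transport (O : {set 'I_n}) (f : 'I_n -> 'I_n) (r : 'I_n) : R :=
  \sum_(o in O) ahead M r o (f o).

(* The partner of [t] is rerouted to the partner of [u], which is affordable
   because [ahead M r] satisfies the triangle inequality. *)
Lemma transport_swap (O A : {set 'I_n}) (f : 'I_n -> 'I_n) (r t u : 'I_n) :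
  {in O &, injective f} -> {in O, forall o, f o \in A} ->
  u \in O -> (r \in O -> u = r) -> (r \in A -> t = r) ->
  exists g, [/\ {in swap O r u &, injective g},
    {in swap O r u, forall o, g o \in swap A r t}, g r = r
    & transport (swap O r u) g r <=
      transport O f r - ahead M r u (f u) + ahead M r t (f u)].
Proof.
move=> injf fA uO rO rA.
(* [r] is matched with itself; a page matched with the departing [t] takes [f u], which the
   departure of [u] frees. *)
pose g o := if o == r then r else if f o == t then f u else f o.
have gr : g r = r by rewrite /g eqxx.
have inD o : o \in swap O r u -> o != r -> o \in O /\ o != u.
  by rewrite !inE => /orP[/eqP -> /eqP|/andP[]].
have gA o : o \in swap O r u -> o != r -> g o \in A /\ g o != t.
  move=> oS or; have [oO ou] := inD o oS or.
  rewrite /g (negPf or); case: eqP => [fot|/eqP fot]; last by rewrite fA.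
  split; first exact: fA.
  by apply: contra_neq ou => fut; apply: injf; rewrite // fut.
exists g; split=> //.
(* If [r] is in [A] then [t = r], so avoiding [t] means avoiding [r]. *)
- have gNr o : o \in swap O r u -> o != r -> g o != r.
    move=> oS or; have [goA got] := gA o oS or.
    by apply: contra_neq got => gor; rewrite gor in goA *; rewrite rA.
  move=> x y xS yS.
  have [->|xr] := eqVneq x r; have [->//|yr] := eqVneq y r.
  + by rewrite gr => /esym/eqP; rewrite (negPf (gNr _ yS yr)).
  + by rewrite gr => /eqP; rewrite (negPf (gNr _ xS xr)).
  have [xO xu] := inD x xS xr; have [yO yu] := inD y yS yr.
  rewrite /g (negPf xr) (negPf yr).
  case: eqP => fx; case: eqP => fy.
  + by move=> _; apply: injf; rewrite // fx.
  + by move/(injf _ _ uO yO) => e; rewrite e eqxx in yu.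
  + by move/(injf _ _ xO uO) => e; rewrite e eqxx in xu.
  + exact: injf.
- move=> o oS; have [->|or] := eqVneq o r; first by rewrite gr setU11.
  by have [goA got] := gA o oS or; rewrite !inE goA got orbT.
- have rNO : r \notin O :\ u.
    by rewrite !inE; apply/negP => /andP[ru /rO ur]; rewrite ur eqxx in ru.
  rewrite /transport /swap big_setU1 //= gr ahead_diag add0r.
  rewrite [\sum_(o in O) _](big_setD1 u) //= [_ + _ - _]addrC addKr.
  have gE o : o \in O :\ u -> g o = if f o == t then f u else f o.
    by move=> oO; rewrite /g; case: eqP => // e; rewrite -e oO in rNO.
  have [/exists_inP[h hO /eqP fh]|/exists_inPn noh] :=
    boolP [exists h in O :\ u, f h == t].
    rewrite (big_setD1 h) // [in leRHS](big_setD1 h) //= (gE h hO) fh eqxx.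
    rewrite (eq_bigr (fun o => ahead M r o (f o))) => [|o].
      by have := ahead_triangle stM M_gt0 r h t (f u); lra.
    rewrite inE => /andP[oh oO]; rewrite gE // -fh; case: eqP => // /injf e.
    move: oh; rewrite e ?inE ?eqxx //; first by move: oO; rewrite inE => /andP[].
    by move: hO; rewrite inE => /andP[].
  rewrite (eq_bigr (fun o => ahead M r o (f o))) => [|o oO].
    by rewrite lerDl ahead_ge0.
  by rewrite gE // (negPf (noh _ oO)).
Qed.

(** By injectivity [r] occurs only in the pair with itself, which contributes nothing; all other
    pairs avoid [r], and their terms are harmonic there. *)
Lemma transport_mean (O : {set 'I_n}) (f : 'I_n -> 'I_n) (r : 'I_n) :
  {in O &, injective f} -> r \in O -> f r = r ->
  \sum_s M r s * transport O f s = transport O f r.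
Proof.
move=> injf rO fr; rewrite /transport.
under eq_bigr do rewrite mulr_sumr.
rewrite exchange_big; apply: eq_bigr => o oO /=.
have [->|or] := eqVneq o r.
  by rewrite fr ahead_diag big1 // => s _; rewrite ahead_diag mulr0.
apply: ahead_harmonic; rewrite // eq_sym //.
by apply: contra_neq or => for_r; apply: injf; rewrite // fr.
Qed.

(** Amortized analysis with the potential [transport], by induction on the horizon: both policies
    serve the same requests, and their evictions are drawn independently. *)
Lemma cost_compare (piA piO : policy R n) (a : R) :
  (forall h (c : {set 'I_n}) r q, c != set0 -> r \notin c -> q \in c ->
     \sum_t piA h c r t * ahead M r t q <= 1 - a) ->
  a <= 1 ->
  forall (T : nat) (nu : 'I_n -> R) h h' (A O : {set 'I_n}) (f : 'I_n -> 'I_n),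
    is_dist nu -> A != set0 -> O != set0 ->
    {in O &, injective f} -> {in O, forall o, f o \in A} ->
    a * cost_from M piA nu T h A <=
    cost_from M piO nu T h' O + \sum_r nu r * transport O f r.
Proof.
move=> dom a1; elim=> [|T IH] nu h h' A O f nu1 A0 O0 injf fA.
  rewrite !cost_from0 mulr0 add0r; apply: sumr_ge0 => r _.
  by rewrite mulr_ge0 ?nu1.1 // sumr_ge0 // => o _; rewrite ahead_ge0.
rewrite !cost_fromS // mulr_sumr -big_split /=; apply: ler_sum => r _.
rewrite -mulrDr mulrCA; apply: ler_wpM2l; first exact: nu1.1.
pose DA := leave piA h A r; pose DO := leave piO h' O r.
pose EA t := cost_from M piA (M r) T (rcons h (trace A r t)) (swap A r t).
pose EO u := cost_from M piO (M r) T (rcons h' (trace O r u)) (swap O r u).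
have DA1 : \sum_t DA t = 1 by exact: sum_leave.
have DO1 : \sum_u DO u = 1 by exact: sum_leave.
have stepAO t u : DA t != 0 -> DO u != 0 ->
    a * EA t <= EO u + (transport O f r - ahead M r u (f u) + ahead M r t (f u)).
  move=> /(leave_supp A0)[tA rA] /(leave_supp O0)[uO rO].
  have [g [injg gA gr le_g]] := transport_swap injf fA uO rO rA.
  apply: le_trans (IH _ _ (rcons h' (trace O r u)) _ _ g (stM r) _ _ injg gA) _.
  - exact: swap_neq0.
  - exact: swap_neq0.
  - by rewrite lerD2l transport_mean // setU11.
(* With [u] fixed and [t] averaged, the dominance hypothesis is applied to the single page [f u]. *)
have meanA u : DO u != 0 ->
    a * \sum_t DA t * ((r \notin A)%:R + EA t) <=
    (r \notin O)%:R + EO u + transport O f r.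
  move=> DOu; have [uO rO] := leave_supp O0 DOu.
  pose Y := EO u + transport O f r - ahead M r u (f u).
  have -> : \sum_t DA t * ((r \notin A)%:R + EA t) =
      (r \notin A)%:R + \sum_t DA t * EA t.
    under eq_bigr do rewrite mulrDr.
    by rewrite big_split /= -mulr_suml DA1 mul1r.
  have : a * \sum_t DA t * EA t <= Y + \sum_t DA t * ahead M r t (f u).
    rewrite mulr_sumr -[Y]mul1r -DA1 mulr_suml -big_split /=.
    apply: ler_sum => t _; have [->|DAt] := eqVneq (DA t) 0.
      by rewrite !mul0r mulr0 addr0.
    rewrite mulrCA -mulrDr ler_wpM2l ?leave_ge0 //.
    by apply: le_trans (stepAO t u DAt DOu) _; rewrite /Y; lra.
  (* A miss of [piA] costs [a] plus at most [1 - a] of potential. It is paid by a miss of [piO] or,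
     if [r] is in [O], by the released term [ahead M r r (f r)], which is 1. *)
  have sum_ahead : a * (r \notin A)%:R + \sum_t DA t * ahead M r t (f u) <=
      (r \notin O)%:R + ahead M r u (f u).
    rewrite /DA /leave; have [rA|rA] /= := boolP (r \in A).
      rewrite mulr0 add0r (bigD1 r) //= eqxx mul1r big1 ?addr0 => [|t /negPf ->];
        last by rewrite mul0r.
      have [/rO ->|_] /= := boolP (r \in O); first by rewrite add0r.
      by apply: le_trans (ahead_le1 stM M_gt0 _ _ _) _; rewrite lerDl ahead_ge0.
    have := dom h A r (f u) A0 rA (fA u uO).
    have [/rO ur|_] /= := boolP (r \in O); last first.
      by have := ahead_ge0 stM M_gt0 r u (f u); lra.
    rewrite ur ahead_source //; first by lra.
    by apply: contraNneq rA => ->; rewrite -ur fA.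
  by rewrite mulrDr /Y; lra.
have meanO x : \sum_u DO u * x = x by rewrite -mulr_suml DO1 mul1r.
rewrite -[leLHS]meanO -[X in _ <= _ + X]meanO -big_split /=.
apply: ler_sum => u _; rewrite -/(DO u).
have [->|DOu] := eqVneq (DO u) 0; first by rewrite !mul0r addr0.
by rewrite -mulrDr ler_wpM2l ?leave_ge0 ?meanA.
Qed.

End Compare.

(** * Dominating distributions from an approximate matrix *)

(** The evicted page is a near-optimal strategy of a game given by the cache and the request. The
    payoff is skew for every [Mh], and the junk diagonal of [hit] cancels. *)
Lemma dominating_policy (R : realType) (n : nat) (Mh : 'M[R]_n) (e : R) :
  0 < e -> exists pi : policy R n,
    forall h (c : {set 'I_n}) (r q : 'I_n), c != set0 -> q \in c ->
      \sum_t pi h c r t * (hit Mh t q r - hit Mh q t r) <= e.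
Proof.
move=> e0.
have /boolp.choice[D DP] : forall cr : {set 'I_n} * 'I_n, exists D : 'I_n -> R,
    cr.1 != set0 -> [/\ is_dist D, forall q, q \notin cr.1 -> D q = 0
      & forall q, q \in cr.1 ->
          \sum_t D t * (hit Mh t q cr.2 - hit Mh q t cr.2) <= e].
  move=> [c r] /=; have [->|c0] := eqVneq c set0; first by exists (fun=> 0).
  have skew p q : hit Mh p q r - hit Mh q p r = - (hit Mh q p r - hit Mh p q r).
    by rewrite opprB.
  by have [D DP] := skew_game skew e0 c0; exists D.
have Ddist (h : seq (event n)) (c : {set _}) r :
    c != set0 -> r \notin c -> is_dist (D (c, r)).
  by move=> c0 _; have [] := DP (c, r) c0.
have Dcache (h : seq (event n)) (c : {set _}) r q :
    c != set0 -> r \notin c -> q \notin c -> D (c, r) q = 0.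
  by move=> c0 _ qc; have [_ D0 _] := DP (c, r) c0; apply: D0.
exists (@Policy R n (fun h c r => D (c, r)) Ddist Dcache) => h c r q c0 qc /=.
by have [_ _] := DP (c, r) c0; apply.
Qed.

Lemma mxnorm_oo_ge (R : realType) (n : nat) (A : 'M[R]_n) (r : 'I_n) :
  \sum_s `|A r s| <= mxnorm_oo A.
Proof. exact: (le_bigmax _ (fun i => \sum_s `|A i s|)). Qed.

Lemma mxnorm_oo_mul (R : realType) (n : nat) (A : 'M[R]_n) (w : 'I_n -> R)
    (b : R) (r : 'I_n) :
  (forall s, `|w s| <= b) -> `|\sum_s A r s * w s| <= mxnorm_oo A * b.
Proof.
move=> wb; have b0 : 0 <= b by apply: le_trans (wb r).
apply: le_trans (ler_norm_sum _ _ _) _.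
apply: le_trans (_ : (\sum_s `|A r s|) * b <= _).
  by rewrite mulr_suml; apply: ler_sum => s _; rewrite normrM ler_wpM2l.
by rewrite ler_wpM2r // mxnorm_oo_ge.
Qed.

Lemma sum_invmx (R : realType) (n : nat) (A : 'M[R]_n) (v : 'I_n -> R)
    (s : 'I_n) :
  A \in unitmx -> \sum_t invmx A s t * (\sum_u A t u * v u) = v s.
Proof.
move=> uA; pose V : 'cV[R]_n := \col_u v u.
have /matrixP/(_ s 0) : invmx A *m (A *m V) = V by rewrite mulKmx.
rewrite !mxE => <-; apply: eq_bigr => t _; rewrite mxE.
by congr (_ * _); apply: eq_bigr => u _; rewrite mxE.
Qed.

Section Perturb.
Variables (R : realType) (n : nat) (M Mh : 'M[R]_n) (p q : 'I_n) (g eta eps : R).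
Hypotheses (stM : stochastic M) (M_gt0 : forall i j, 0 < M i j) (pq : p != q).
Hypotheses (norm_g : mxnorm_oo (invmx (Lmx M p q)) <= g).
Hypothesis closeM : forall r, \sum_s `|Mh r s - M r s| <= eta.
Hypotheses (g_eta : g * eta <= eps / 4) (eps_gt0 : 0 < eps) (eps_lt : eps < 1 / 2).

Lemma Lmx_sub (v : 'I_n -> R) (b : R) (r : 'I_n) : (forall s, `|v s| <= b) ->
  `|\sum_s Lmx M p q r s * v s - \sum_s Lmx Mh p q r s * v s| <= eta * b.
Proof.
move=> vb; have b0 : 0 <= b by apply: le_trans (vb r).
have eta0 : 0 <= eta by apply: le_trans (closeM r); apply: sumr_ge0.
rewrite !sum_Lmx; case: ifP => _; first by rewrite subrr normr0 mulr_ge0.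
rewrite opprB addrA subrK distrC -sumrB.
apply: le_trans (ler_norm_sum _ _ _) _.
apply: le_trans (_ : (\sum_s `|Mh r s - M r s|) * b <= _).
  rewrite mulr_suml; apply: ler_sum => s _.
  by rewrite -mulrBl normrM ler_wpM2l.
by rewrite ler_wpM2r.
Qed.

Lemma Lmx_bound (v : 'I_n -> R) (b : R) :
  (forall r, `|\sum_s Lmx M p q r s * v s| <= b) -> forall s, `|v s| <= g * b.
Proof.
move=> Lv s; have b0 : 0 <= b by apply: le_trans (Lv s).
rewrite -(sum_invmx v s (Lmx_unit stM M_gt0 p q)).
apply: le_trans (mxnorm_oo_mul (invmx (Lmx M p q)) s Lv) _.
by rewrite ler_wpM2r.
Qed.

(** A kernel vector of maximum [b] satisfies [b <= g * eta * b] with [g * eta < 1]. *)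
Lemma Lmx_perturb_unit : Lmx Mh p q \in unitmx.
Proof.
apply: unitmx_inj => v Lv s.
pose b := \big[Order.max/0]_s `|v s|.
have vb t : `|v t| <= b by exact: (le_bigmax _ (fun s => `|v s|)).
have b0 : 0 <= b by apply: le_trans (vb s).
have : b <= g * (eta * b).
  apply: bigmax_le => [|t _]; last first.
    by apply: Lmx_bound => r; have := Lmx_sub r vb; rewrite Lv subr0.
  apply: le_trans (_ : `|v s| <= _) => //.
  by apply: Lmx_bound => r; have := Lmx_sub r vb; rewrite Lv subr0.
rewrite mulrA => le_b; apply/normr0_eq0/eqP; rewrite eq_le normr_ge0 andbT.
apply: le_trans (vb s) _.
by move: (ler_wpM2r b0 g_eta) (ler_wpM2r b0 (ltW eps_lt)); lra.
Qed.

(** The error [d] is sent by [Lmx M p q] to the difference of the two matrices applied to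
    [hit Mh p q]. As [Mh] is arbitrary, the latter is bounded only by [1 + b], whence
    [b <= eps / 4 * (1 + b)]. *)
Lemma hit_close (r : 'I_n) : `|hit Mh p q r - hit M p q r| <= eps / 2.
Proof.
pose d s := hit Mh p q s - hit M p q s.
pose b := \big[Order.max/0]_s `|d s|.
have db t : `|d t| <= b by exact: (le_bigmax _ (fun s => `|d s|)).
have b0 : 0 <= b by apply: le_trans (db r).
have hb t : `|hit Mh p q t| <= 1 + b.
  rewrite (_ : hit Mh p q t = hit M p q t + d t); last by rewrite /d; ring.
  apply: le_trans (ler_normD _ _) _; apply: lerD => //.
  by rewrite ger0_norm ?hit_ge0 ?hit_le1.
have dle t : `|d t| <= g * (eta * (1 + b)).
  apply: Lmx_bound => s; have := Lmx_sub s hb.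
  rewrite sum_Lmx_hit ?Lmx_perturb_unit //.
  rewrite -(sum_Lmx_hit s (Lmx_unit stM M_gt0 p q)) -sumrB.
  by under eq_bigr do rewrite -mulrBr.
have : b <= g * (eta * (1 + b)).
  by apply: bigmax_le => [|t _] //; apply: le_trans (dle r).
rewrite mulrA => le_b; apply: le_trans (db r) _.
have b1 : 0 <= 1 + b by rewrite addr_ge0.
by move: (ler_wpM2r b1 g_eta) (ler_wpM2r b0 (ltW eps_lt)); lra.
Qed.

End Perturb.

(** For [t != q], [ahead M r t q] is 1/2 plus half the game payoff for [M]. Replacing [M] by [Mh]
    costs [eps / 2], and the payoff bound another [eps / 2]. *)
Lemma dominating_perturb (R : realType) (n : nat) (M Mh : 'M[R]_n)
    (pi : policy R n) h (c : {set 'I_n}) (r q : 'I_n) (eps : R) :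
  stochastic M -> (forall i j, 0 < M i j) ->
  (forall s t, s != t -> `|hit Mh s t r - hit M s t r| <= eps / 2) -> 0 <= eps ->
  c != set0 -> r \notin c ->
  \sum_t pi h c r t * (hit Mh t q r - hit Mh q t r) <= eps ->
  \sum_t pi h c r t * ahead M r t q <= 1 / 2 + eps.
Proof.
move=> stM M0 close eps0 c0 rc dom.
have [pi0 pi1] := evict_dist pi h c0 rc.
apply: le_trans (_ : \sum_t pi h c r t *
  (1 / 2 + eps / 2 + (hit Mh t q r - hit Mh q t r) / 2) <= _).
  apply: ler_sum => t _; apply: ler_wpM2l => //.
  have [->|tq] := eqVneq t q; first by rewrite ahead_diag subrr; lra.
  have := hit_compl stM M0 r tq; have qt : q != t by rewrite eq_sym.
  move: (close _ _ tq) (close _ _ qt); rewrite /ahead (negPf tq) !ler_norml.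
  move=> /andP[? ?] /andP[? ?]; lra.
under eq_bigr do rewrite mulrDr mulrA.
rewrite big_split /= -!mulr_suml pi1 mul1r; lra.
Qed.

Section Gamma.
Variables (R : realType) (n : nat) (M : 'M[R]_n).

Lemma gamma_ge (p q : 'I_n) : p != q ->
  mxnorm_oo (invmx (Lmx M p q)) <= gamma M.
Proof.
move=> pq; apply: ub_le_sup; last by exists p, q.
(* Finitely many nonnegative values are bounded by their sum. *)
exists (\sum_u \sum_v mxnorm_oo (invmx (Lmx M u v))) => _ [u [v [_ ->]]].
have norm0 a b : 0 <= mxnorm_oo (invmx (Lmx M a b)).
  by apply: le_trans (mxnorm_oo_ge _ a); apply: sumr_ge0.
rewrite (bigD1 u) //= (bigD1 v) //= -addrA lerDl addr_ge0 //.
  exact: sumr_ge0.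
by apply: sumr_ge0 => *; apply: sumr_ge0.
Qed.

Lemma gamma_ge1 : stochastic M -> (forall i j, 0 < M i j) -> (1 < n)%N ->
  1 <= gamma M.
Proof.
move=> stM M0 n1; have n0 : (0 < n)%N by apply: ltnW.
pose p := Ordinal n0; pose q := Ordinal n1; have pq : p != q by [].
apply: le_trans (gamma_ge pq); apply: le_trans (mxnorm_oo_ge _ p).
rewrite (bigD1 p) //= -/(hit M p q p) hit_source // normr1 lerDl.
exact: sumr_ge0.
Qed.

End Gamma.

(** * Competitive ratio of a dominating policy *)

Lemma competitive_dominating (R : realType) (n : nat) (M : 'M[R]_n)
    (pi : policy R n) (c0 : {set 'I_n}) (eps : R) :
  stochastic M -> (forall i j, 0 < M i j) -> c0 != set0 ->
  0 < eps -> eps < 1 / 2 ->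
  (forall h (c : {set 'I_n}) r q, c != set0 -> r \notin c -> q \in c ->
     \sum_t pi h c r t * ahead M r t q <= 1 / 2 + eps) ->
  competitive (2 / (1 - 2 * eps)) M c0 pi.
Proof.
move=> stM M0 c00 eps0 eps12 dom nu T nu1.
have a_gt0 : 0 < 1 / 2 - eps by lra.
have -> : 2 / (1 - 2 * eps) = (1 / 2 - eps)^-1 by field; lra.
rewrite mulrC ler_pdivlMr // mulrC; apply: lb_le_inf.
  by exists (expected_cost nu M c0 pi T), pi.
move=> _ [piO ->].
have dom' h (c : {set 'I_n}) r q : c != set0 -> r \notin c -> q \in c ->
    \sum_t pi h c r t * ahead M r t q <= 1 - (1 / 2 - eps).
  by move=> *; apply: le_trans (dom _ _ _ _ _ _ _) _ => //; lra.
(* Both policies start from the same cache, where the identity matching has potential zero. *)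
have start0 : \sum_r nu r * transport M c0 id r = 0.
  by apply: big1 => r _; rewrite /transport big1 ?mulr0 // => o _;
    rewrite ahead_diag.
rewrite -[leRHS]addr0 -start0; apply: cost_compare => //; lra.
Qed.

(** This covers [n <= 1], where [gamma M] is 0 by convention and the dataset is empty. *)
Lemma competitive_full (R : realType) (n : nat) (M : 'M[R]_n)
    (pi : policy R n) (a : R) : 0 <= a -> competitive a M [set: 'I_n] pi.
Proof.
move=> a0 nu T _.
have cost0 (pi' : policy R n) : expected_cost nu M [set: 'I_n] pi' T = 0.
  apply: big1 => w _.
  suff : forall h (v : seq (event n)),
      run_prob pi' h [set: 'I_n] v * (misses [set: 'I_n] v)%:R = 0 :> R.
    by rewrite -mulrA => ->; rewrite mulr0.
  move=> h v; elim: v h => [|[r [u|]] v IH] h /=; first by rewrite mulr0.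
    by rewrite /step_prob /= inE !mul0r.
  by rewrite /step_prob /= !inE mul1r add0n IH.
rewrite cost0 mulr_ge0 //; apply: lb_le_inf; first by exists 0, pi; rewrite cost0.
by move=> _ [pi' ->]; rewrite cost0.
Qed.

(** * Estimation of the transition matrix *)

(* The argument [v] of [g] is the number of earlier visits to [i]. *)
Fixpoint path_sum (R : realType) (n : nat) (i : 'I_n)
    (g : nat -> 'I_n -> 'I_n -> R) (v : nat) (x : 'I_n) (s : seq 'I_n) : R :=
  if s is y :: s' then g v x y + path_sum i g (v + (x == i)) y s' else 0.

Definition early (n : nat) (i : 'I_n) (K v : nat) (x : 'I_n) : bool :=
  (x == i) && (v < K)%N.

(* Only the first [K] visits to [i] are used, so that on trajectories with
   enough visits the denominator is the constant [K]. *)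
Definition estimate (R : realType) (n : nat) (K : nat) (xs : seq 'I_n) :
    'M[R]_n :=
  \matrix_(i, j) if xs is x :: s then
    path_sum i (fun v x y => (early i K v x)%:R * (y == j)%:R) 0 x s / K%:R
  else 0.

(** Increments of [K] times the estimation error at [(i, j)], provided that [K] visits to [i]
    occur. *)
Definition noise (R : realType) (n : nat) (M : 'M[R]_n) (i j : 'I_n) (K v : nat)
    (x y : 'I_n) : R :=
  (early i K v x)%:R * ((y == j)%:R - M i j).

(* The importance weight [delta / M x i] makes the drift of the visit count
   independent of the current page and keeps each term at most [1]. *)
Definition visit_drift (R : realType) (n : nat) (M : 'M[R]_n) (delta : R)
    (i : 'I_n) (v : nat) (x y : 'I_n) : R :=
  (y == i)%:R * (delta / M x i) - delta.

Section Mean.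
Variables (R : realType) (n : nat) (M : 'M[R]_n).
Hypothesis stM : stochastic M.

Definition mean (mu : 'I_n -> R) (L : nat) (F : seq 'I_n -> R) : R :=
  \sum_(X : L.-tuple 'I_n) chain_prob mu M X * F X.

Lemma mean0 mu (F : seq 'I_n -> R) : mean mu 0 F = F [::].
Proof. by rewrite /mean (sum_tuple0 (fun X => chain_prob mu M X * F X)) mul1r. Qed.

Lemma meanS mu L (F : seq 'I_n -> R) :
  mean mu L.+1 F = \sum_x mu x * mean (M x) L (fun s => F (x :: s)).
Proof.
rewrite /mean (sum_tupleS L (fun X => chain_prob mu M X * F X)).
apply: eq_bigr => x _; rewrite mulr_sumr; apply: eq_bigr => s _.
by rewrite chain_prob_cons mulrA.
Qed.

Lemma meanD mu L (F G : seq 'I_n -> R) :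
  mean mu L (fun s => F s + G s) = mean mu L F + mean mu L G.
Proof. by rewrite /mean -big_split; apply: eq_bigr => X _; rewrite mulrDr. Qed.

Lemma meanZ mu L a (F : seq 'I_n -> R) :
  mean mu L (fun s => a * F s) = a * mean mu L F.
Proof. by rewrite /mean mulr_sumr; apply: eq_bigr => X _; rewrite mulrCA. Qed.

Lemma mean_sum mu L (I : finType) (F : I -> seq 'I_n -> R) :
  mean mu L (fun s => \sum_i F i s) = \sum_i mean mu L (F i).
Proof.
by rewrite /mean exchange_big; apply: eq_bigr => X _; rewrite mulr_sumr.
Qed.

Lemma mean_const mu L a : is_dist mu -> mean mu L (fun=> a) = a.
Proof.
elim: L mu => [|L IH] mu mu1; first by rewrite mean0.
by rewrite meanS -[RHS]mul1r -mu1.2 mulr_suml; apply: eq_bigr => x _; rewrite IH.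
Qed.

Lemma chain_prob_ge0 mu (s : seq 'I_n) : is_dist mu -> 0 <= chain_prob mu M s.
Proof.
elim: s mu => [|x s IH] mu mu1 //.
by rewrite chain_prob_cons mulr_ge0 ?mu1.1 ?IH.
Qed.

(** Markov's inequality: outside [E] the nonnegative [F] is at least 1. *)
Lemma chain_Pr_ge mu m (E : m.-tuple 'I_n -> Prop) (F : seq 'I_n -> R) (e : R) :
  is_dist mu -> (forall s, 0 <= F s) ->
  (forall X : m.-tuple 'I_n, F X < 1 -> E X) ->
  mean mu m F <= e -> 1 - e <= chain_Pr mu M E.
Proof.
move=> mu1 F0 FE meanF; apply: le_trans (_ : 1 - mean mu m F <= _).
  by rewrite lerD2l lerN2.
rewrite -{1}(mean_const m 1 mu1) /mean /chain_Pr -sumrB [leRHS]big_mkcond /=.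
apply: ler_sum => X _; have c0 := chain_prob_ge0 X mu1.
rewrite -mulrBr; case: asboolP => [_|nE].
  by apply: ler_piMr => //; rewrite gerBl.
by apply: mulr_ge0_le0 => //; rewrite subr_le0 leNgt; apply/negP => /FE.
Qed.

Section Martingale.
Variables (i : 'I_n) (g : nat -> 'I_n -> 'I_n -> R).
Hypothesis g_centered : forall v x, \sum_y M x y * g v x y = 0.

Lemma mean_path_sum L v x : mean (M x) L (path_sum i g v x) = 0.
Proof.
elim: L v x => [|L IH] v x; first by rewrite mean0.
rewrite meanS -[RHS](g_centered v x); apply: eq_bigr => y _; congr (_ * _) => /=.
by rewrite meanD mean_const // IH addr0.
Qed.

(** Martingale increments are orthogonal, so their variances add up; [b v L] budgets the variance of
    [L] further steps after [v] visits. *)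
Lemma mean_path_sum_sqr (b : nat -> nat -> R) :
  (forall v, 0 <= b v 0) ->
  (forall v x L, \sum_y M x y * g v x y ^+ 2 + b (v + (x == i))%N L <= b v L.+1) ->
  forall L v x, mean (M x) L (fun s => path_sum i g v x s ^+ 2) <= b v L.
Proof.
move=> b0 bS; elim=> [|L IH] v x; first by rewrite mean0 expr0n.
rewrite meanS; apply: le_trans (bS v x L).
rewrite -[X in _ <= _ + X](sum_stoch stM x) -big_split /=.
apply: ler_sum => y _; rewrite -mulrDr; apply: ler_wpM2l; first exact: (stM x).1.
pose P := path_sum i g (v + (x == i)) y.
have -> : mean (M y) L (fun s => (g v x y + P s) ^+ 2) =
    g v x y ^+ 2 + mean (M y) L (fun s => P s ^+ 2).
  rewrite (_ : (fun s => _) =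
    (fun s => (g v x y ^+ 2 + (2 * g v x y) * P s) + P s ^+ 2)).
    by rewrite !meanD mean_const // meanZ mean_path_sum mulr0 addr0.
  by apply: functional_extensionality_dep => s; ring.
by rewrite lerD2l IH.
Qed.

End Martingale.

Lemma sum_indic (x : 'I_n) (a : 'I_n -> R) : \sum_y (y == x)%:R * a y = a x.
Proof.
rewrite (bigD1 x) //= eqxx mul1r big1 ?addr0 // => y /negPf ->.
by rewrite mul0r.
Qed.

(** Each of the at most [K] visits used contributes the Bernoulli variance [M i j - M i j ^ 2],
    whatever [L] is. *)
Lemma mean_noise_sqr K i j L x :
  mean (M x) L (fun s => path_sum i (noise M i j K) 0 x s ^+ 2) <= K%:R * M i j.
Proof.
have moment x' (a : R) : \sum_y M x' y * ((y == j)%:R - a) =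
    M x' j - a.
  under eq_bigr do rewrite mulrBr [_ * (_ == _)%:R]mulrC.
  by rewrite sumrB sum_indic (sum_stoch stM).
have Mij0 : 0 <= M i j by exact: (stM i).1.
have center v y : \sum_z M y z * noise M i j K v y z = 0.
  rewrite /noise; under eq_bigr do rewrite mulrCA.
  rewrite -mulr_sumr moment /early; case: eqP => [->|_]; last by rewrite mul0r.
  by rewrite subrr mulr0.
have := mean_path_sum_sqr center (b := fun v _ => (K - v)%:R * M i j) _ _ L 0 x.
rewrite subn0; apply=> [v|v y _].
  by rewrite mulr_ge0.
rewrite /noise /early; case: eqP => [->|_] /=; last first.
  by rewrite addn0 big1 ?add0r // => z _; rewrite mul0r expr0n mulr0.
have [vK|Kv] := ltnP v K; last first.
  rewrite big1 ?add0r => [|z _]; last by rewrite mul0r expr0n mulr0.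
  by rewrite ler_wpM2r // ler_nat leq_sub2l // leq_addr.
rewrite addn1 -(subnSK vK) -natr1 mulrDl mul1r addrC lerD2l.
rewrite (eq_bigr (fun z => (1 - 2 * M i j) * (M i z * ((z == j)%:R - M i j))
  + M i z * (M i j - M i j ^+ 2))) => [|z _]; last first.
  by case: (z == j) => /=; ring.
rewrite big_split /= -mulr_sumr moment subrr mulr0 add0r (sum_stoch stM).
by rewrite gerBl sqr_ge0.
Qed.

(** A step from [y] has variance [delta * w - delta ^ 2], with [w = delta / M y i] at most 1. *)
Lemma mean_drift_sqr (delta : R) i L x :
  0 < delta -> (forall k l, delta <= M k l) ->
  mean (M x) L (fun s => path_sum i (visit_drift M delta i) 0 x s ^+ 2) <=
  L%:R * delta.
Proof.
move=> d0 Md; have M0 k l : 0 < M k l by apply: lt_le_trans (Md k l).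
have center v y : \sum_z M y z * visit_drift M delta i v y z = 0.
  rewrite /visit_drift; under eq_bigr do rewrite mulrBr mulrCA.
  rewrite sumrB sum_indic (sum_stoch stM) mulrCA divff ?mulr1 ?subrr //.
  exact: lt0r_neq0.
apply: (mean_path_sum_sqr center (b := fun _ L => L%:R * delta)) => [v|v y L'].
  by rewrite mul0r.
rewrite -[L'.+1%:R]natr1 mulrDl mul1r addrC lerD2l.
pose w := delta / M y i.
have w1 : w <= 1 by rewrite ler_pdivrMr ?mul1r.
rewrite (eq_bigr (fun z => (z == i)%:R * (M y z * w ^+ 2)
  - 2 * delta * ((z == i)%:R * (M y z * w)) + M y z * delta ^+ 2)) => [|z _];
  last first.
  by rewrite /visit_drift -/w; case: (z == i) => /=; ring.
rewrite big_split sumrB /= -mulr_sumr !sum_indic (sum_stoch stM).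
have Mw : M y i * w = delta by rewrite /w mulrCA divff ?mulr1 // lt0r_neq0.
rewrite expr2 mulrA Mw.
have : delta * w <= delta by rewrite ler_piMr // ltW.
by have := sqr_ge0 delta; lra.
Qed.

End Mean.

Lemma sqr_sum_le (R : realFieldType) (n : nat) (a : 'I_n -> R) :
  (\sum_j a j) ^+ 2 <= n%:R * \sum_j a j ^+ 2.
Proof.
apply: le_trans (_ : \sum_j \sum_k (a j ^+ 2 / 2 + a k ^+ 2 / 2) <= _).
  rewrite expr2 mulr_suml; apply: ler_sum => j _.
  rewrite mulr_sumr; apply: ler_sum => k _.
  by have := sqr_ge0 (a j - a k); rewrite sqrrB; lra.
have const (b : R) : \sum_(j < n) b = n%:R * b.
  by rewrite sumr_const card_ord mulr_natl.
under eq_bigr do rewrite big_split /= const -mulr_suml.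
by rewrite big_split /= const -mulr_sumr -mulr_suml; lra.
Qed.

Section Deviation.
Variables (R : realType) (n : nat) (M : 'M[R]_n) (delta eta : R) (K L : nat).
Hypothesis stM : stochastic M.
Hypotheses (delta_gt0 : 0 < delta) (Mdelta : forall i j, delta <= M i j).
Hypotheses (eta_gt0 : 0 < eta) (K_gt0 : (0 < K)%N).
Hypothesis K_le : K%:R <= L%:R * delta / 2.

(** One statistic for the whole union bound. For each page the first term reaches 1 once the drift
    sum falls to [- L * delta / 2], the second once the Cauchy-Schwarz bound on the l1 error reaches
    [eta]. *)
Definition deviation (xs : seq 'I_n) : R :=
  if xs is x :: s then
    \sum_i ((2 / (L%:R * delta)) ^+ 2 *
              path_sum i (visit_drift M delta i) 0 x s ^+ 2 +
            n%:R / (eta * K%:R) ^+ 2 *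
              \sum_j path_sum i (noise M i j K) 0 x s ^+ 2)
  else 0.

Lemma deviation_ge0 xs : 0 <= deviation xs.
Proof.
case: xs => [|x s] //=; apply: sumr_ge0 => i _; apply: addr_ge0.
  by rewrite mulr_ge0 ?sqr_ge0.
rewrite mulr_ge0 ?divr_ge0 ?sqr_ge0 ?ler0n //.
by apply: sumr_ge0 => j _; apply: sqr_ge0.
Qed.

Let Ld_gt0 : 0 < L%:R * delta.
Proof.
have K1 : 0 < K%:R :> R by rewrite ltr0n.
by have := lt_le_trans K1 K_le; lra.
Qed.

Lemma mean_deviation mu : is_dist mu ->
  mean M mu L.+1 deviation <=
  n%:R * (4 / (L%:R * delta) + n%:R / (eta ^+ 2 * K%:R)).
Proof.
move=> mu1; rewrite meanS.
apply: le_trans (_ : \sum_x mu x *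
  (n%:R * (4 / (L%:R * delta) + n%:R / (eta ^+ 2 * K%:R))) <= _); last first.
  by rewrite -mulr_suml mu1.2 mul1r.
apply: ler_sum => x _; apply: ler_wpM2l; first exact: mu1.1.
have K1 : 0 < K%:R :> R by rewrite ltr0n.
set B := 4 / _ + _; apply: le_trans (_ : \sum_(i < n) B <= _); last first.
  by rewrite sumr_const card_ord mulr_natl.
rewrite /= mean_sum; apply: ler_sum => i _.
rewrite meanD !meanZ mean_sum; apply: lerD.
  apply: le_trans (_ : (2 / (L%:R * delta)) ^+ 2 * (L%:R * delta) <= _).
    by apply: ler_wpM2l; [exact: sqr_ge0 | exact: mean_drift_sqr].
  have := lt0r_neq0 Ld_gt0; rewrite mulf_eq0 negb_or => /andP[L0 d0].
  by rewrite le_eqVlt; apply/orP; left; apply/eqP; field; rewrite L0 d0.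
apply: le_trans (_ : n%:R / (eta * K%:R) ^+ 2 * (K%:R * \sum_j M i j) <= _).
  apply: ler_wpM2l; first by rewrite divr_ge0 ?sqr_ge0.
  by rewrite mulr_sumr; apply: ler_sum => j _; apply: mean_noise_sqr.
(* Summing the variances over [j] gives [K] and not [n * K], as the row sums to one. *)
rewrite (stM i).2 le_eqVlt; apply/orP; left; apply/eqP; field.
by rewrite !lt0r_neq0.
Qed.

(** Visits are counted in [belast x s] because the last page has no successor. *)
Lemma path_sum_visits (i : 'I_n) v x s :
  (K <= v + count_mem i (belast x s))%N ->
  path_sum i (fun v x _ => (early i K v x)%:R) v x s = (K - v)%:R :> R.
Proof.
elim: s v x => [|y s IH] v x /=.
  by rewrite addn0 -subn_eq0 => /eqP ->.
rewrite addnA => /IH ->; rewrite /early; case: (x == i) => /=; last first.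
  by rewrite addn0 add0r.
have [vK|Kv] /= := ltnP v K.
  by rewrite addn1 -(subnSK vK) -[RHS]natr1 addrC.
have /eqP -> : (K - v == 0)%N by rewrite subn_eq0.
have /eqP -> : (K - (v + 1) == 0)%N by rewrite subn_eq0 (leq_trans Kv) ?leq_addr.
by rewrite addr0.
Qed.

(** The weights are at most 1, so few visits force a very negative drift sum. *)
Lemma path_sum_drift_le (i : 'I_n) v x s :
  path_sum i (visit_drift M delta i) v x s <=
  (count_mem i s)%:R - (size s)%:R * delta.
Proof.
elim: s v x => [|y s IH] v x /=; first by rewrite mul0r subrr.
have := IH (v + (x == i))%N y.
rewrite natrD -[(size s).+1%:R]natr1 /visit_drift.
have : delta / M x i <= 1.
  by rewrite ler_pdivrMr ?mul1r // (lt_le_trans delta_gt0).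
by case: (y == i) => /=; lra.
Qed.

Lemma path_sum_noise (i j : 'I_n) v x s :
  path_sum i (noise M i j K) v x s =
  path_sum i (fun v x y => (early i K v x)%:R * (y == j)%:R) v x s -
  path_sum i (fun v x _ => (early i K v x)%:R) v x s * M i j.
Proof.
elim: s v x => [|y s IH] v x /=; first by rewrite mul0r subrr.
by rewrite IH /noise; ring.
Qed.

Lemma estimate_close (x : 'I_n) (s : seq 'I_n) : size s = L ->
  deviation (x :: s) < 1 ->
  forall i, \sum_j `|estimate R K (x :: s) i j - M i j| <= eta.
Proof.
move=> sL dev i.
have K1 : 0 < K%:R :> R by rewrite ltr0n.
have eK : 0 < eta * K%:R by rewrite mulr_gt0.
pose D := path_sum i (visit_drift M delta i) 0 x s.
pose S j := path_sum i (noise M i j K) 0 x s.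
have {dev} : (2 / (L%:R * delta)) ^+ 2 * D ^+ 2 +
    n%:R / (eta * K%:R) ^+ 2 * \sum_j S j ^+ 2 < 1.
  apply: le_lt_trans dev; rewrite /= [leRHS](bigD1 i) //= lerDl.
  apply: sumr_ge0 => k _; apply: addr_ge0.
    by rewrite mulr_ge0 ?sqr_ge0.
  rewrite mulr_ge0 ?divr_ge0 ?sqr_ge0 ?ler0n //.
  by apply: sumr_ge0 => j _; apply: sqr_ge0.
set a := _ * D ^+ 2; set b := _ * \sum_j _ => ab.
have a0 : 0 <= a by rewrite mulr_ge0 ?sqr_ge0.
have b0 : 0 <= b.
  rewrite mulr_ge0 ?divr_ge0 ?sqr_ge0 ?ler0n //.
  by apply: sumr_ge0 => j _; apply: sqr_ge0.
have visits : (K <= count_mem i (belast x s))%N.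
  rewrite leqNgt; apply/negP => ltK.
  (* The final page may add one visit; the strict inequality [ltK] absorbs it. *)
  have cK : (count_mem i s <= K)%N.
    apply: leq_trans (_ : (count_mem i (x :: s) <= _)%N); first exact: leq_addl.
    rewrite lastI -cats1 count_cat /= addn0; apply: leq_trans ltK.
    by rewrite -addn1 leq_add2l leq_b1.
  have : D <= - (L%:R * delta / 2).
    apply: le_trans (path_sum_drift_le i 0 x s) _; rewrite sL.
    have : (count_mem i s)%:R <= K%:R :> R by rewrite ler_nat.
    by move: K_le; lra.
  move=> DL; suff : 1 <= a by lra.
  rewrite /a -exprMn -sqrrN exprn_ege1 // -mulrN mulrAC ler_pdivlMr //.
  by lra.
have est j : estimate R K (x :: s) i j - M i j = S j / K%:R.
  rewrite mxE /S path_sum_noise path_sum_visits // subn0.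
  by field; exact: lt0r_neq0.
rewrite (eq_bigr (fun j => `|S j| / K%:R)) => [|j _]; last first.
  by rewrite est normrM (gtr0_norm (_ : 0 < K%:R^-1)) ?invr_gt0.
rewrite -mulr_suml ler_pdivrMr // -ler_sqr ?nnegrE ?sumr_ge0 ?(ltW eK) //.
apply: le_trans (sqr_sum_le _) _.
rewrite (eq_bigr (fun j => S j ^+ 2)) => [|j _]; last first.
  by rewrite real_normK ?num_real.
have : b < 1 by lra.
by rewrite /b mulrAC ltr_pdivrMr ?exprn_gt0 // mul1r => /ltW.
Qed.

End Deviation.

(** * Constants and conclusion *)

(** The visit counts contribute at most [2 / (130 * 100)] and the noise at most [128 / (130 * 100)]
    to the failure probability, in all 1/100. *)
Lemma sample_bound (R : realType) (G N eps delta m K : R) :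
  1 <= G -> 2 <= N -> 0 < eps -> eps < 1 / 2 -> 0 < delta -> delta <= 1 ->
  130 * 100 * (G ^+ 2 * N ^+ 2 / (eps ^+ 2 * delta)) <= m ->
  (m - 1) * delta / 2 < K + 1 ->
  1 <= K /\
  N * (4 / ((m - 1) * delta) + N / ((eps / (4 * G)) ^+ 2 * K)) <= 1 / 100.
Proof.
move=> G1 N2 e0 e12 d0 d1 le_m K_gt.
have G0 : 0 < G by lra.
pose B := G ^+ 2 * N ^+ 2 / eps ^+ 2.
have mB : 130 * 100 * B <= m * delta.
  rewrite -ler_pdivrMr //; apply: le_trans le_m.
  by rewrite le_eqVlt /B; apply/orP; left; apply/eqP; field; rewrite !lt0r_neq0.
have BN : 4 * N <= B.
  rewrite /B ler_pdivlMr ?exprn_gt0 //.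
  have e2 : eps ^+ 2 <= 1 / 4 by nra.
  have G2 : 1 <= G ^+ 2 by nra.
  have N0 : 0 <= N ^+ 2 := sqr_ge0 N.
  have : N ^+ 2 <= G ^+ 2 * N ^+ 2 by rewrite ler_peMl.
  have : 4 * N * eps ^+ 2 <= 4 * N * (1 / 4) by rewrite ler_wpM2l //; lra.
  have : 2 * N <= N ^+ 2 by rewrite expr2 ler_wpM2r //; lra.
  lra.
have etaB : (eps / (4 * G)) ^+ 2 * B = N ^+ 2 / 16.
  by rewrite /B; field; rewrite !lt0r_neq0.
have eta0 : 0 < (eps / (4 * G)) ^+ 2 by rewrite exprn_gt0 // divr_gt0 ?mulr_gt0.
set eta2 := (_ / _) ^+ 2 in etaB eta0 *.
(* Giving up a factor 2 here and again in [KB] absorbs the loss of one sample and the rounding of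
   [K], since [BN] makes [B] at least 8. *)
have Ld : 130 * 50 * B <= (m - 1) * delta by lra.
have KB : 130 * 100 / 8 * B <= K by lra.
split; first by lra.
have first_le : N * 4 / ((m - 1) * delta) <= 2 / (130 * 100).
  rewrite ler_pdivrMr; last by lra.
  by lra.
have second_le : N * N / (eta2 * K) <= 128 / (130 * 100).
  rewrite ler_pdivrMr; last by rewrite mulr_gt0 //; lra.
  have := ler_wpM2l (ltW eta0) KB; rewrite mulrCA etaB; lra.
by rewrite mulrDr !mulrA; lra.
Qed.

Theorem theorem7 (R : realType) :
  exists C : R, 0 < C /\
    forall (n k : nat) (c0 : {set 'I_n}) (delta eps : R),
      (0 < k)%N -> #|c0| = k ->
      0 < delta -> 0 < eps -> eps < 1 / 2 ->
      exists A : seq 'I_n -> policy R n,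
        forall (M : 'M[R]_n) (mu : 'I_n -> R),
          stochastic M -> (forall i j, delta <= M i j) -> is_dist mu ->
          99%:R / 100%:R <=
            chain_Pr mu M
              (fun X : (sample_size C eps delta M).-tuple 'I_n =>
                 competitive (2 / (1 - 2 * eps)) M c0 (A X)).
Proof.
exists (130 * 100); split=> [|n k c0 delta eps k0 c0k d0 e0 e12]; first by lra.
have c00 : c0 != set0 by rewrite -card_gt0 c0k.
(* The cutoff uses only [delta] and the number of transitions, one less than the number of samples;
   the algorithm thus needs no value of [gamma M]. *)
pose visits (xs : seq 'I_n) := Num.truncn ((size xs).-1%:R * delta / 2).
have /boolp.choice[A AP] :=
  fun xs => dominating_policy (estimate R (visits xs) xs) e0.
exists A => M mu stM Md mu1.
have M0 i j : 0 < M i j by apply: lt_le_trans (Md i j).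
rewrite (_ : 99%:R / 100%:R = 1 - 1 / 100); last by lra.
set m := sample_size _ _ _ _.
have [n1|n1] := leqP n 1.
  have -> : c0 = [set: 'I_n].
    apply/eqP; rewrite eqEcard subsetT cardsT card_ord c0k.
    exact: leq_trans n1 k0.
  apply: (chain_Pr_ge stM (F := fun=> 0)) => // [X _|].
    by apply: competitive_full; rewrite divr_ge0 //; lra.
  by rewrite mean_const //; lra.
pose G := gamma M; have G1 : 1 <= G by exact: gamma_ge1.
have n2 : 2 <= n%:R :> R by rewrite ler_nat.
have d1 : delta <= 1.
  pose i := Ordinal (ltnW n1).
  by apply: le_trans (Md i i) _; rewrite -(stM i).2 (bigD1 i) //= lerDl sumr_ge0
    // => j _; rewrite ltW.
have le_m : 130 * 100 * (G ^+ 2 * n%:R ^+ 2 / (eps ^+ 2 * delta)) <= m%:R.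
  rewrite /m /sample_size; set z := 130 * 100 * _.
  have z0 : 0 <= z.
    rewrite /z; apply: mulr_ge0; first by rewrite mulr_ge0 ?ler0n.
    by apply: divr_ge0; rewrite mulr_ge0 ?sqr_ge0 // ltW.
  apply: le_trans (ceil_ge z) _.
  rewrite -[X in X%:~R]gez0_abs // ceil_ge0; lra.
have m1 : (0 < m)%N.
  rewrite -(ltr0n R); apply: lt_le_trans le_m.
  apply: mulr_gt0; first by lra.
  by apply: divr_gt0; rewrite mulr_gt0 ?exprn_gt0 //; lra.
pose L := m.-1; have mL : m = L.+1 by rewrite prednK.
pose K := Num.truncn (L%:R * delta / 2).
have LE : L%:R = m%:R - 1 :> R by rewrite mL -natr1 addrK.
have /andP[K_le K_gt] : K%:R <= L%:R * delta / 2 < K.+1%:R.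
  by apply: truncn_itv; rewrite !mulr_ge0 ?ler0n ?invr_ge0 // ltW.
have [K1 bound] : 1 <= K%:R :> R /\ n%:R * (4 / (L%:R * delta) +
    n%:R / ((eps / (4 * G)) ^+ 2 * K%:R)) <= 1 / 100 :> R.
  rewrite LE; apply: sample_bound => //.
  by rewrite -LE natr1.
(* This accuracy [eta] gives [G * eta = eps / 4], as the perturbation bound requires. *)
have eta0 : 0 < eps / (4 * G) by rewrite divr_gt0 // mulr_gt0 //; lra.
have K0 : (0 < K)%N by rewrite -(ler_nat R).
apply: (chain_Pr_ge stM (F := deviation M delta (eps / (4 * G)) K L)) => //.
- exact: deviation_ge0.
- move=> X; have : size X = m by rewrite size_tuple.
  case: (tval X) (AP X) => [|x s]; first by rewrite mL.
  move=> AX; rewrite mL => -[sL] dev.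
  have visK : visits (x :: s) = K by rewrite /visits /= sL.
  rewrite visK in AX.
  have close := estimate_close d0 Md eta0 K0 K_le sL dev.
  apply: competitive_dominating => // h c r q c_neq0 rc qc.
  apply: (dominating_perturb (Mh := estimate R K (x :: s))) => //;
    [| exact: ltW | exact: AX].
  move=> p t pt; apply: (hit_close stM M0 pt (gamma_ge _ pt) close) => //.
  rewrite -/G (_ : G * _ = eps / 4) //; field.
  exact: lt0r_neq0 (lt_le_trans ltr01 G1).
- by rewrite mL; apply: le_trans bound; apply: mean_deviation.
Qed.
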